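(* Let $X,Y\subset\mathbb{R}^n$ be open domains and let $c(x,y)=\Psi(x-y)$ be a $\Psi$-cost, where $\Psi:\mathcal{M}\to\mathbb{R}$ is a convex function on an open domain $\mathcal{M}\subset\mathbb{R}^n$ with $X-Y\subset\mathcal{M}$. Then $Y$ is $c$-convex relative to $X$ if and only if, for all $x\in X$, the set $x-Y=\{x-y: y\in Y\}\subset\mathcal{M}$ is geodesically convex with respect to the dual connection $D^*$.
   Context: $X-Y=\{x-y: x\in X, y\in Y\}$. The function $\Psi$ is smooth enough ($C^4$) with positive definite Hessian, and the dual coordinates $\theta_i=\partial\Psi/\partial u^i$ form a coordinate system on $\mathcal{M}$ (that is, $\nabla\Psi$ is injective on $\mathcal{M}$), where $u^1,\dots,u^n$ are the Euclidean coordinates on $\mathcal{M}$. Hessian structure: $\mathcal{M}$ carries the Riemannian metric $g_{ij}=\partial_{u^i}\partial_{u^j}\Psi$ and the flat connection $D$ given by differentiation in the $u$-coordinates. The dual connection $D^*$ is defined by $\mathcal{X}(g(\mathcal{Y},\mathcal{Z}))=g(D_{\mathcal{X}}\mathcal{Y},\mathcal{Z})+g(\mathcal{Y},D^*_{\mathcal{X}}\mathcal{Z})$ for all vector fields; it is the flat connection given by differentiation in the dual coordinates $\theta$. A subset $S\subset\mathcal{M}$ is geodesically convex with respect to $D^*$ if any two points of $S$ are joined by a $D^*$-geodesic that is contained in $S$. Relative $c$-convexity: the $c$-exponential map is defined by $c\text{-}\exp_x(p)=y \iff p=-c_x(x,y)$, where $c_x$ is the gradient of $c$ in $x$. For $x\in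 X$, the $c$-segment with respect to $x$ joining $y_0,y_1$ is the curve $c\text{-}\exp_x(\ell)$, where $\ell$ is the line segment in $\mathbb{R}^n$ from $-c_x(x,y_0)$ to $-c_x(x,y_1)$. The set $Y$ is $c$-convex relative to $X$ if for every $x\in X$ and all $y_0,y_1\in Y$, the $c$-segment with respect to $x$ joining $y_0$ and $y_1$ lies in $Y$, i.e. for every $p\in\ell$ there is $y\in Y$ with $-c_x(x,y)=p$. *)

(* Defs.v *)
(* MathComp-Analysis; R^n is 'rV[R]_n with R : realType. *)
From HB Require Import structures.
From mathcomp Require Import all_boot all_order all_algebra.
From mathcomp Require Import all_classical all_reals all_analysis.

Set Implicit Arguments.
Unset Strict Implicit.
Unset Printing Implicit Defensive.

Import Order.TTheory GRing.Theory Num.Theory.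
Import numFieldNormedType.Exports.

Local Open Scope classical_set_scope.
Local Open Scope ring_scope.

Definition open_domain (T : topologicalType) (A : set T) : Prop :=
  open A /\ connected A.

(* C^k on M, with (Frechet) derivatives taken in the ambient space, so this is
   meant for open M; values of f outside M are irrelevant. *)
Fixpoint Ck (R : realType) (n : nat) (W : normedModType R) (k : nat)
    (M : set 'rV[R]_n) (f : 'rV[R]_n -> W) {struct k} : Prop :=
  match k with
  | 0 => forall x, M x -> {for x, continuous f}
  | k'.+1 => (forall x, M x -> differentiable f x) /\
             (forall v : 'rV[R]_n, Ck k' M (fun x => 'D_v f x))
  end.

(* M need not be convex, and f is arbitrary outside M, so the convexity
   inequality is required on the convex subsets of M (equivalently, along the
   segments contained in M). For M convex this is convex_function M f. *)
Definition convex_on (R : realType) (n : nat) (M : set 'rV[R]_n)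
    (f : 'rV[R]_n -> R) : Prop :=
  forall A : set 'rV[R]_n, convex_set A -> A `<=` M -> convex_function A f.

Section Coordinates.
Variables (R : realType) (n : nat).
Implicit Types (f : 'rV[R]_n -> R) (x y v w : 'rV[R]_n) (M S : set 'rV[R]_n).

Definition basis_vec (i : 'I_n) : 'rV[R]_n := delta_mx 0 i.

Definition gradient f x : 'rV[R]_n := \row_i 'D_(basis_vec i) f x.

Definition hessian f x : 'M[R]_n :=
  \matrix_(i, j) 'D_(basis_vec i) (fun z => 'D_(basis_vec j) f z) x.

Definition metric := 'rV[R]_n -> 'rV[R]_n -> 'rV[R]_n -> R.

Definition hessian_metric f : metric :=
  fun x v w => (v *m hessian f x *m w^T) 0 0.

Definition positive_definite_on M (g : metric) : Prop :=
  forall x v, M x -> v != 0 -> 0 < g x v v.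

(* The tangent spaces of M are identified with R^n by the coordinates u, so a
   vector field is the row of its components. *)
Definition vector_field M (X : 'rV[R]_n -> 'rV[R]_n) : Prop := Ck 1 M X.

(* nabla X Y x is the value at x of the field nabla_X Y. *)
Definition connection :=
  ('rV[R]_n -> 'rV[R]_n) -> ('rV[R]_n -> 'rV[R]_n) -> 'rV[R]_n -> 'rV[R]_n.

Definition flat_connection : connection := fun X Y x => 'D_(X x) Y x.

(* X(g(Y,Z)) = g(nabla_X Y, Z) + g(Y, nabla*_X Z). For g of class C^1 and
   positive definite, this identity determines nabla* on M; in particular no
   connection axioms have to be imposed on it. *)
Definition dual_connection M (g : metric) (nabla nablastar : connection) : Prop :=
  forall X Y Z, vector_field M X -> vector_field M Y -> vector_field M Z ->
  forall x, M x ->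
    'D_(X x) (fun z => g z (Y z) (Z z)) x =
    g x (nabla X Y x) (Z x) + g x (Y x) (nablastar X Z x).

(* The components of christoffel nabla x i j are the Gamma^k_ij at x. *)
Definition christoffel (nabla : connection) x (i j : 'I_n) : 'rV[R]_n :=
  nabla (cst (basis_vec i)) (cst (basis_vec j)) x.

(* nabla_(gamma') gamma', in coordinates. *)
Definition covariant_acceleration (nabla : connection)
    (gamma : R -> 'rV[R]_n) (t : R) : 'rV[R]_n :=
  derive1 (derive1 gamma) t +
  \sum_(i < n) \sum_(j < n)
    (derive1 gamma t 0 i * derive1 gamma t 0 j) *: christoffel nabla (gamma t) i j.

Definition geodesic_on M (nabla : connection) (a b : R)
    (gamma : R -> 'rV[R]_n) : Prop :=
  forall t, a < t < b ->
    [/\ M (gamma t), derivable gamma t 1, derivable (derive1 gamma) t 1 &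
        covariant_acceleration nabla gamma t = 0].

(* A geodesic parametrized by [0, 1] is the restriction of one defined on an
   open interval ]a, b[ containing [0, 1]; only the part over [0, 1] has to
   lie in S. *)
Definition geodesically_convex M (nabla : connection) S : Prop :=
  forall p q, S p -> S q ->
  exists (gamma : R -> 'rV[R]_n) (a b : R),
    [/\ a < 0 /\ 1 < b, geodesic_on M nabla a b gamma,
        gamma 0 = p /\ gamma 1 = q &
        forall t, 0 <= t <= 1 -> S (gamma t)].

Definition cost := 'rV[R]_n -> 'rV[R]_n -> R.

Definition psi_cost f : cost := fun x y => f (x - y).

Definition cost_gradx (c : cost) x y : 'rV[R]_n := gradient (c ^~ y) x.

(* c-exp_x as a relation: it need be neither total nor single-valued for a
   general cost. *)
Definition c_exp (c : cost) x (p y : 'rV[R]_n) : Prop :=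
  p = - cost_gradx c x y.

Definition c_convex_relative_to (c : cost) (Y X : set 'rV[R]_n) : Prop :=
  forall x, X x -> forall y0 y1, Y y0 -> Y y1 ->
  forall t : R, 0 <= t <= 1 ->
  exists2 y, Y y &
    c_exp c x ((1 - t) *: - cost_gradx c x y0 + t *: - cost_gradx c x y1) y.

End Coordinates.

Arguments connection : clear implicits.
Arguments flat_connection {R n}.

(* Main.v *)
Require Import Defs.
From HB Require Import structures.
From mathcomp Require Import all_boot all_order all_algebra.
From mathcomp Require Import all_classical all_reals all_analysis.
From mathcomp Require Import ring lra.
Import Order.TTheory GRing.Theory Num.Theory.
Import numFieldNormedType.Exports.
Local Open Scope classical_set_scope.
Local Open Scope ring_scope.

(** In the dual coordinates theta = grad Psi both notions of convexity say the
    same thing about line segments.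

    On the cost side, the gradient of c in x at (x, y) is theta(x - y), so the
    c-segment with respect to x joining y0 and y1 consists of the points y for
    which theta(x - y) lies on the segment from theta(x - y0) to
    theta(x - y1): the relation is affine in theta, and the two minus signs
    cancel.

    On the geometric side, write H for the Hessian of Psi and Gamma for the
    Christoffel symbols of D*.  Testing the duality relation on constant
    vector fields gives Gamma_ij H = (d_i H_jk)_k
    ([christoffel_mul_hessian]).  Along a curve gamma in M one has
    (theta o gamma)' = gamma' H(gamma), and differentiating once more
    produces exactly the covariant acceleration of gamma times H(gamma)
    ([is_derive_momentum]).  As H is invertible, gamma is a D*-geodesic if and
    only if theta o gamma is affine.

    If each x - Y is geodesically convex, theta maps the geodesic from x - y0
    to x - y1 onto the segment ([gradient_geodesic_affine]), and the points of
    this geodesic are the x - y needed for c-convexity.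

    Conversely, let Y be c-convex.  The segment from theta(x - y0) to
    theta(x - y1) is covered by theta(x - Y), and one has to see that its
    preimage is a curve of the required regularity, defined on a slightly
    larger interval.  Here theta is an open map ([gradient_open_map]): for tau
    near theta(p), the function Psi - <tau, .> attains its minimum over a
    small closed ball around p in the interior, because p is a strict minimum
    of Psi - <theta(p), .> there, H being positive definite; and at the
    minimum theta = tau.  Openness extends the segment beyond its endpoints
    and, with the injectivity of theta, makes the preimage curve gamma
    continuous.  Then gamma is differentiable with gamma' = d H(gamma)^-1,
    where d is the direction of the segment ([is_derive_implicit]), so gamma'
    is differentiable in turn, gamma' H(gamma) is constant and the covariant
    acceleration vanishes ([dual_geodesic_of_affine]). *)

(** * Derivatives along curves *)

Lemma is_derive_uniq {R : realType} {V W : normedModType R} (f : V -> W) x v df1 df2 :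
  is_derive x v f df1 -> is_derive x v f df2 -> df1 = df2.
Proof. by move=> [_ <-] [_ <-]. Qed.

Lemma is_derive_comp_curve {R : realType} {V W : normedModType R} (F : V -> W)
    (gamma : R -> V) (t : R) (v : V) :
  is_derive t 1 gamma v -> differentiable F (gamma t) ->
  is_derive t 1 (F \o gamma) ('D_v F (gamma t)).
Proof.
move=> [dg <-] dF; have /derivable1_diffP dg' := dg.
have dc : differentiable (F \o gamma) t by exact: differentiable_comp.
apply: DeriveDef; first exact/derivable1_diffP.
by rewrite !deriveE// diff_comp.
Qed.

Lemma is_derive_line {R : realType} {V : normedModType R} (p v : V) (t : R) :
  is_derive t 1 (fun s => p + s *: v) v.
Proof.
have dZ : is_derive t 1 (fun s : R => s *: v) v.
  apply: DeriveDef; first by apply/derivable1_diffP; exact: differentiableZl.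
  by rewrite deriveE; [rewrite diff_val scale1r|exact: differentiableZl].
have /= := is_deriveD (is_derive_cst p t 1) dZ.
by rewrite add0r.
Qed.

Lemma MVT_line {R : realType} {V : normedModType R} (F : V -> R) (p v : V) (s : R) :
  0 < s -> (forall t, 0 <= t <= s -> differentiable F (p + t *: v)) ->
  exists2 t, 0 < t < s & F (p + s *: v) - F p = s * 'D_v F (p + t *: v).
Proof.
move=> s0 dF.
have dline t : 0 <= t <= s ->
    is_derive t 1 (F \o (fun s => p + s *: v)) ('D_v F (p + t *: v)).
  by move=> ts; apply: is_derive_comp_curve; [exact: is_derive_line|exact: dF].
have dline_in t : t \in `]0, s[%R ->
    is_derive t 1 (F \o (fun s => p + s *: v)) ('D_v F (p + t *: v)).
  by move=> /[!in_itv]/= /andP[t0 ts]; apply: dline; rewrite !ltW.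
have [|t] := @MVT _ _ (fun t => 'D_v F (p + t *: v)) _ _ s0.
- apply: derivable_within_continuous => t /[!in_itv]/= ts.
  by apply: ex_derive; exact: dline.
rewrite in_itv/= scale0r addr0 subr0 => ts e; exists t => //.
by rewrite mulrC.
Qed.

(** The derivatives at 0 and 1 are two-sided, hence the larger interval. *)
Lemma affine_of_derive2_0 {R : realType} (f df : R -> R) (a b : R) :
  a < 0 -> 1 < b ->
  (forall t, a < t < b -> is_derive t 1 f (df t)) ->
  (forall t, a < t < b -> is_derive t 1 df 0) ->
  forall t, 0 <= t <= 1 -> f t = (1 - t) * f 0 + t * f 1.
Proof.
move=> a0 b1 dfE ddfE.
have mvt (g dg : R -> R) (s : R) : (forall t, a < t < b -> is_derive t 1 g (dg t)) ->
    0 <= s <= 1 -> exists2 c, 0 <= c <= 1 & g s - g 0 = dg c * s.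
  move=> dgE /andP[s0 s1].
  have ab t : 0 <= t <= s -> a < t < b.
    move=> /andP[t0 ts]; rewrite (lt_le_trans a0 t0)/=.
    by rewrite (le_lt_trans ts)// (le_lt_trans s1).
  have dg_in t : t \in `]0, s[ -> is_derive t 1 g (dg t).
    by rewrite in_itv/= => /andP[? ?]; apply: dgE; apply: ab; rewrite !ltW.
  have cg : {within `[0, s], continuous g}.
    apply: derivable_within_continuous => t; rewrite in_itv/= => ts.
    exact: (@ex_derive _ _ _ _ _ _ _ (dgE _ (ab _ ts))).
  have [c] := MVT_segment s0 dg_in cg.
  rewrite in_itv/= subr0 => /andP[c0 cs] gE; exists c => //.
  by rewrite c0 (le_trans cs).
have dfc c : 0 <= c <= 1 -> df c = df 0.
  move=> /(mvt df (cst 0) _ ddfE)[c1 _ /eqP].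
  by rewrite /cst mul0r subr_eq0 => /eqP.
move=> t t01; have [c /dfc -> ft] := mvt f df t dfE t01.
have [|c1 /dfc -> f1] := mvt f df 1 dfE; first by rewrite ler01 lexx.
have -> : f 1 = f 0 + df 0 by rewrite -[LHS](subrK (f 0)) f1 mulr1 addrC.
by rewrite -[LHS](subrK (f 0)) ft; ring.
Qed.

(** * Symmetry of second derivatives *)

Lemma second_differenceC {R : realType} (u v w z : R) :
  u - v - (w - z) = u - w - (v - z).
Proof. by ring. Qed.

Lemma square_cancel {R : realType} (s d d' u u' : R) : s != 0 ->
  d = s * (s * u) -> d' = s * (s * u') -> d = d' -> u = u'.
Proof. by move=> s0 -> -> /(mulfI s0)/(mulfI s0). Qed.

(** Two applications of the mean value theorem, first in the direction w to
    y |-> F (p + s u + y w) - F (p + y w), then in the direction u to D_w F. *)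
Lemma second_difference_mvt {R : realType} {n : nat} (M : set 'rV[R]_n)
    (F : 'rV[R]_n -> R) (u w p : 'rV[R]_n) (s : R) :
  Ck 2 M F -> 0 < s ->
  (forall x y : R, 0 <= x <= s -> 0 <= y <= s -> M (p + x *: u + y *: w)) ->
  exists x y : R, [/\ 0 < x < s, 0 < y < s &
    F (p + s *: u + s *: w) - F (p + s *: u) - (F (p + s *: w) - F p) =
      s * (s * 'D_u ('D_w F) (p + x *: u + y *: w))].
Proof.
move=> [dF CF] s0 Msq; have s00 : (0 : R) <= (0 : R) <= s by rewrite lexx ltW.
have ss0 : 0 <= s <= s by rewrite lexx ltW.
pose phi y := F (p + s *: u + y *: w) - F (p + y *: w).
pose dphi y := 'D_w F (p + s *: u + y *: w) - 'D_w F (p + y *: w).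
have dphiE y : 0 <= y <= s -> is_derive y 1 phi (dphi y).
  move=> ys; apply: is_deriveB.
    apply: (is_derive_comp_curve F (fun y => p + s *: u + y *: w)).
      exact: is_derive_line.
    by apply: dF; exact: Msq.
  apply: (is_derive_comp_curve F (fun y => p + y *: w)).
    exact: is_derive_line.
  by apply: dF; have := Msq 0 y s00 ys; rewrite scale0r addr0.
have [||y] := @MVT _ phi dphi 0 s s0.
- by move=> y /[!in_itv]/= /andP[? ?]; apply: dphiE; rewrite !ltW.
- apply: derivable_within_continuous => y /[!in_itv]/= ys.
  by apply: ex_derive; exact: dphiE.
rewrite in_itv/= => /andP[y0 ys].
rewrite /phi !scale0r !addr0 subr0 => Ey.
have ys' : 0 <= y <= s by rewrite !ltW.
have [|x xs Ex] := @MVT_line _ _ ('D_w F) (p + y *: w) u s s0.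
  by move=> x xs; apply: (CF w).1; rewrite addrAC; exact: Msq.
exists x, y; split=> //; first by rewrite y0.
transitivity (F (p + s *: u + s *: w) - F (p + s *: w) - (F (p + s *: u) - F p)).
  exact: second_differenceC.
rewrite Ey /dphi [p + s *: u + _]addrAC Ex mulrC.
by rewrite [p + _ + _]addrAC.
Qed.

(** The second difference of F over a parallelogram is symmetric in its two
    sides, and it is s^2 times either mixed derivative of F, each taken at its
    own point of the parallelogram. *)
Lemma derive_mixed_meet {R : realType} {n : nat} (M : set 'rV[R]_n)
    (F : 'rV[R]_n -> R) (a b p : 'rV[R]_n) (s : R) :
  Ck 2 M F -> 0 < s ->
  (forall x y : R, 0 <= x <= s -> 0 <= y <= s -> M (p + x *: a + y *: b)) ->
  exists x y x' y' : R,
    [/\ 0 < x < s, 0 < y < s, 0 < x' < s, 0 < y' < s &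
      'D_a ('D_b F) (p + x *: a + y *: b) =
      'D_b ('D_a F) (p + x' *: a + y' *: b)].
Proof.
move=> C2F s0 Mab.
have [x [y [xs ys E]]] := second_difference_mvt _ _ _ _ _ _ C2F s0 Mab.
have [|y' [x' [ys' xs' E']]] := second_difference_mvt _ _ b a p _ C2F s0.
  by move=> y' x' ? ?; rewrite addrAC; exact: Mab.
exists x, y, x', y'; split; [exact: xs|exact: ys|exact: xs'|exact: ys'|].
rewrite (addrAC p (y' *: b)) (addrAC p (s *: b)) in E'.
exact: (square_cancel _ _ _ _ _ (lt0r_neq0 s0) E E' (second_differenceC _ _ _ _)).
Qed.

Lemma dist_meet {R : realType} (e a b c d : R) :
  `|a - c| < e / 2 -> `|b - d| < e / 2 -> c = d -> `|a - b| <= e.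
Proof.
move=> ac + cd; rewrite -cd distrC => cb.
by rewrite (le_trans (ler_distD c _ _))// [leRHS]splitr lerD// ltW.
Qed.

(** Schwarz's theorem: shrink the parallelogram of [derive_mixed_meet] to p
    and use the continuity of both mixed derivatives. *)
Lemma derive_mixedC {R : realType} {n : nat} (M : set 'rV[R]_n)
    (F : 'rV[R]_n -> R) (a b p : 'rV[R]_n) :
  open M -> Ck 2 M F -> M p ->
  'D_a (fun z => 'D_b F z) p = 'D_b (fun z => 'D_a F z) p.
Proof.
move=> Mopen C2F Mp; have [_ CF] := C2F.
apply/eqP; rewrite -subr_eq0 -normr_le0; apply/ler_addgt0Pl => /= e e0.
have e2 : 0 < e / 2 by rewrite divr_gt0.
have nearM : \forall z \near p, M z by exact: open_nbhs_nbhs.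
have nearab : \forall z \near p, `|'D_a ('D_b F) p - 'D_a ('D_b F) z| < e / 2.
  by have /cvgrPdist_lt := (CF b).2 a p Mp; apply.
have nearba : \forall z \near p, `|'D_b ('D_a F) p - 'D_b ('D_a F) z| < e / 2.
  by have /cvgrPdist_lt := (CF a).2 b p Mp; apply.
have [r /= r0 near_p] :=
  (nbhs_normP _ _).1 (filterI nearM (filterI nearab nearba)).
(* The side s = r / k keeps the parallelogram inside the ball of radius r. *)
pose k := `|a| + `|b| + 1.
have k0 : 0 < k by rewrite ltr_wpDl// addr_ge0.
pose s := r / k; have s0 : 0 < s by rewrite divr_gt0.
have in_ball (x y : R) : 0 <= x <= s -> 0 <= y <= s ->
    ball_ Num.norm p r (p + x *: a + y *: b).
  move=> /andP[x0 xs] /andP[y0 ys].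
  rewrite /ball_/= -addrA opprD addNKr normrN.
  rewrite (le_lt_trans (ler_normD _ _))// !normrZ !ger0_norm//.
  have -> : r = s * `|a| + s * `|b| + s.
    by rewrite -mulrDr -[X in _ + X]mulr1 -mulrDr /s divfK ?gt_eqF.
  by rewrite ltr_pwDr// lerD// ler_wpM2r.
have Mab x y xs ys := let: conj h _ := near_p _ (in_ball x y xs ys) in h.
have [x [y [x' [y' [xs ys xs' ys' E]]]]] :=
  derive_mixed_meet _ _ _ _ _ _ C2F s0 Mab.
have wk (z : R) : 0 < z < s -> 0 <= z <= s by case/andP=> ? ?; rewrite !ltW.
have [_ [h _]] := near_p _ (in_ball x y (wk x xs) (wk y ys)).
have [_ [_ h']] := near_p _ (in_ball x' y' (wk x' xs') (wk y' ys')).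
by rewrite addr0; exact: (dist_meet _ _ _ _ _ h h' E).
Qed.

(** * Derivatives in coordinates and of matrices *)

Lemma derive_coordE {R : realType} {n : nat} {W : normedModType R}
    (F : 'rV[R]_n -> W) (x v : 'rV[R]_n) : differentiable F x ->
  'D_v F x = \sum_i v 0 i *: 'D_(basis_vec R i) F x.
Proof.
move=> dF; rewrite deriveE// [in LHS](row_sum_delta v) linear_sum.
by apply: eq_bigr => i _; rewrite linearZ /= deriveE.
Qed.

Lemma is_derive_mx {R : realType} {m n : nat} (A : R -> 'M[R]_(m, n)) (t : R)
    (dA : 'M[R]_(m, n)) :
  (forall i j, is_derive t 1 (fun s => A s i j) (dA i j)) -> is_derive t 1 A dA.
Proof.
move=> dAE; have dAt : derivable A t 1.
  by apply/derivable_mxP => i j; case: (dAE i j).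
apply: DeriveDef => //; rewrite derive_mx//; apply/matrixP => i j.
by rewrite mxE; case: (dAE i j).
Qed.

Lemma is_derive_coord {R : realType} {m n : nat} (A : R -> 'M[R]_(m, n)) (t : R)
    (dA : 'M[R]_(m, n)) : is_derive t 1 A dA ->
  forall i j, is_derive t 1 (fun s => A s i j) (dA i j).
Proof.
move=> [derA <-] i j; have /derivable_mxP derAij := derA.
by apply: DeriveDef => //; rewrite derive_mx// mxE.
Qed.

Lemma is_derive_mulmx {R : realType} {m n p : nat} (A : R -> 'M[R]_(m, n))
    (B : R -> 'M[R]_(n, p)) (t : R) (dA : 'M[R]_(m, n)) (dB : 'M[R]_(n, p)) :
  is_derive t 1 A dA -> is_derive t 1 B dB ->
  is_derive t 1 (fun s => A s *m B s) (dA *m B t + A t *m dB).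
Proof.
move=> [/[dup] /derivable_mxP derA derA' <-] [/[dup] /derivable_mxP derB derB' <-].
apply: is_derive_mx => i j.
pose h k (s : R) : R := A s i k * B s k j.
have -> : (fun s => (A s *m B s) i j) = \sum_k h k.
  by apply/funext => s; rewrite mxE fct_sumE.
apply: is_derive_eq.
  by apply: is_derive_sum => k; apply: is_deriveM; apply: derivableP.
rewrite !mxE -big_split/=; apply: eq_bigr => k _.
by rewrite derive_mx// derive_mx// !mxE addrC /= ![_ *: _]mulrC [X in X + _]mulrC.
Qed.

Lemma is_derive_mulmxr {R : realType} {m n p : nat} (A : R -> 'M[R]_(m, n))
    (B : 'M[R]_(n, p)) (t : R) (dA : 'M[R]_(m, n)) :
  is_derive t 1 A dA -> is_derive t 1 (fun s => A s *m B) (dA *m B).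
Proof.
move=> dAE; have := is_derive_mulmx _ _ _ _ _ dAE (is_derive_cst B t 1).
by rewrite mulmx0 addr0.
Qed.

Lemma derivable_big {R : realType} {I : Type} (op : R -> R -> R) (x0 : R)
    (r : seq I) (f : I -> R -> R) (t : R) :
  (forall g h : R -> R, derivable g t 1 -> derivable h t 1 ->
     derivable (fun s => op (g s) (h s)) t 1) ->
  (forall i, derivable (f i) t 1) ->
  derivable (fun s => \big[op/x0]_(i <- r) f i s) t 1.
Proof.
move=> derop df; elim: r => [|i r IH].
  under eq_fun do rewrite big_nil; exact: derivable_cst.
under eq_fun do rewrite big_cons; exact: derop.
Qed.

Lemma derivable_det {R : realType} {n : nat} (A : R -> 'M[R]_n) (t : R) :
  derivable A t 1 -> derivable (fun s => \det (A s)) t 1.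
Proof.
move=> /derivable_mxP dA; apply: derivable_big => [g h|s]; first exact: derivableD.
apply: (@derivableM _ _ (cst _)); first exact: derivable_cst.
by apply: derivable_big => [g h|i]; [exact: derivableM|exact: dA].
Qed.

(** Cramer's rule makes the entries of the inverse rational functions of the
    entries of the matrix. *)
Lemma derivable_invmx {R : realType} {n : nat} (A : R -> 'M[R]_n) (t : R) :
  derivable A t 1 -> (\forall s \near t, A s \in unitmx) ->
  derivable (fun s => invmx (A s)) t 1.
Proof.
move=> dA uA.
apply: (@near_eq_derivable _ _ _ (fun s => (\det (A s))^-1 *: \adj (A s))).
  by apply: filterS uA => s sA; rewrite /invmx sA.
apply/derivable_mxP => i j.
under eq_fun do rewrite !mxE.
have detA0 : \det (A t) != 0.
  by rewrite -unitfE -unitmxE; exact: nbhs_singleton uA.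
apply: (@derivableM _ _ (fun s => (\det (A s))^-1)).
  by apply: derivableV => //; exact: derivable_det.
apply: (@derivableM _ _ (cst _)); first exact: derivable_cst.
apply: derivable_det; apply/derivable_mxP => k l.
by under eq_fun do rewrite !mxE; have /derivable_mxP := dA; exact.
Qed.

Lemma differentiable_mulmxr {R : realType} {m n : nat} (B : 'M[R]_(m, n)) (x : 'rV[R]_m) :
  differentiable (fun u : 'rV[R]_m => u *m B) x.
Proof.
have -> : (fun u : 'rV[R]_m => u *m B) = \sum_j (fun u : 'rV[R]_m => u 0 j *: row j B).
  by apply/funext => u; rewrite fct_sumE mulmx_sum_row.
apply: differentiable_sum => j; apply: differentiableZl.
exact: differentiable_coord.
Qed.

(** * Curves defined implicitly *)

Section implicit_curve.
Context {R : realType} {V : normedModType R}.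

Lemma is_derive_dist (f : R -> V) (t : R) (w : V) :
  is_derive t 1 f w <->
  (forall e, 0 < e ->
     \forall s \near t, `|f s - f t - (s - t) *: w| <= e * `|s - t|).
Proof.
have -> : is_derive t 1 f w <->
    h^-1 *: (f (h *: 1 + t) - f t) @[h --> (0:R)^'] --> w.
  split=> [[dft <-] //|dft]; apply: DeriveDef; first by apply/cvg_ex; exists w.
  exact: cvg_lim.
have distE (h e : R) : h != 0 ->
    (`|w - h^-1 *: (f (h *: 1 + t) - f t)| <= e) =
    (`|f (h + t) - f t - h *: w| <= e * `|h|).
  move=> h0; rewrite -[h *: 1]/(h * 1) mulr1 -ler_pdivrMr ?normr_gt0//.
  rewrite -[in RHS]normfV mulrC -normrZ [in RHS]scalerBr scalerA mulVf// scale1r.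
  by rewrite distrC.
split=> [/cvgrPdist_le dft e e0|dft]; last apply/cvgrPdist_le => e e0.
- rewrite (near_shift 0 t) subr0.
  have := dft e e0; rewrite near_withinE.
  apply: filterS => h /=; rewrite addrK; have [->|h0 + ] := eqVneq h 0.
    by move=> _; rewrite add0r subrr scale0r subr0 !normr0 mulr0.
  by rewrite distE//; exact.
- have := dft e e0; rewrite (near_shift 0 t) subr0 near_withinE.
  by apply: filterS => h /=; rewrite addrK => ? h0; rewrite distE.
Qed.

Lemma diff0_dist (E : V -> V) (p : V) : differentiable E p ->
  (forall v, 'D_v E p = 0) ->
  forall e, 0 < e -> \forall u \near p, `|E u - E p| <= e * `|u - p|.
Proof.
move=> dE E0 e e0; rewrite (near_shift 0 p) subr0.
have /eqaddoP /(_ e e0) := diff_locally dE.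
apply: filterS => v /=; rewrite addrK.
rewrite -![(_ + _ : _ -> _) _]/(_ + _) -![(- _ : _ -> _) _]/(- _) /=.
by rewrite -[(cst _ + _) v]/(E p + 'd E p v) -deriveE// E0 addr0.
Qed.

(** The increment of E o gamma is negligible with respect to that of gamma, so
    gamma = E o gamma + l has, to first order, the increments of l.  The
    continuity of gamma is what gives access to the local behaviour of E.  This
    is used to differentiate the inverse of a map F along a line, with
    E = id - F J^-1 for J the Jacobian matrix of F. *)
Lemma is_derive_implicit (E : V -> V) (gamma l : R -> V) (t : R) (w : V) :
  {for t, continuous gamma} ->
  differentiable E (gamma t) -> (forall v, 'D_v E (gamma t) = 0) ->
  (\forall s \near t, gamma s = E (gamma s) + l s) ->
  is_derive t 1 l w -> is_derive t 1 gamma w.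
Proof.
move=> cgamma dE E0 gammaE /is_derive_dist dl; apply/is_derive_dist => e e0.
have k0 : 0 < `|w| + 1 by rewrite ltr_wpDl.
pose k := 2 * (`|w| + 1).
have {}k0 : 0 < k by rewrite mulr_gt0.
(* The bound 1/2 absorbs the increment of gamma on the right and makes gamma
   k-Lipschitz at t; then c k <= e / 2 bounds the increment of E o gamma. *)
pose c := Num.min (2^-1) (e / 2 / k).
have c0 : 0 < c by rewrite lt_min invr_gt0 !divr_gt0// ltr0n.
have near0 := cgamma _ (diff0_dist _ _ dE E0 c c0).
have near1 := dl 1 ltr01.
have near2 := dl (e / 2) ltac:(by rewrite divr_gt0).
have gammatE := nbhs_singleton gammaE.
near=> s.
have gE : gamma s = E (gamma s) + l s by near: s.
have nE : `|E (gamma s) - E (gamma t)| <= c * `|gamma s - gamma t|.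
  by near: s; exact: near0.
have n1 : `|l s - l t - (s - t) *: w| <= 1 * `|s - t|.
  by near: s; exact: near1.
have n2 : `|l s - l t - (s - t) *: w| <= e / 2 * `|s - t|.
  by near: s; exact: near2.
have dE' : gamma s - gamma t = (E (gamma s) - E (gamma t)) + (l s - l t).
  by rewrite [in LHS]gE [in LHS]gammatE opprD addrACA.
have lb : `|l s - l t| <= (`|w| + 1) * `|s - t|.
  rewrite -[l s - l t](subrK ((s - t) *: w)) (le_trans (ler_normD _ _))//.
  by rewrite normrZ mulrDl addrC [`|w| * _]mulrC lerD.
have gb : `|gamma s - gamma t| <= k * `|s - t|.
  have := ler_normD (E (gamma s) - E (gamma t)) (l s - l t).
  rewrite -dE'.
  have : c * `|gamma s - gamma t| <= 2^-1 * `|gamma s - gamma t|.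
    by rewrite ler_wpM2r// ge_min lexx.
  rewrite /k; lra.
rewrite dE' -addrA (le_trans (ler_normD _ _))//.
have : c * `|gamma s - gamma t| <= e / 2 / k * (k * `|s - t|).
  by rewrite ler_pM ?(ltW c0)// ge_min lexx orbT.
rewrite mulrA divfK ?gt_eqF//.
lra.
Unshelve. all: by end_near. Qed.

End implicit_curve.

(** * The gradient map and its Jacobian *)

Definition dot {R : realType} {n : nat} (u v : 'rV[R]_n) : R :=
  \sum_i u 0 i * v 0 i.

Section dot_product.
Context {R : realType} {n : nat}.
Implicit Types u v w : 'rV[R]_n.

Lemma dotDr u v w : dot u (v + w) = dot u v + dot u w.
Proof. by rewrite -big_split; apply: eq_bigr => i _; rewrite mxE mulrDr. Qed.

Lemma dotBr u v w : dot u (v - w) = dot u v - dot u w.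
Proof. by rewrite -sumrB; apply: eq_bigr => i _; rewrite !mxE mulrBr. Qed.

Lemma dotBl u v w : dot (u - v) w = dot u w - dot v w.
Proof. by rewrite -sumrB; apply: eq_bigr => i _; rewrite !mxE mulrBl. Qed.

Lemma dotZr a u v : dot u (a *: v) = a * dot u v.
Proof. by rewrite mulr_sumr; apply: eq_bigr => i _; rewrite mxE mulrCA. Qed.

Lemma dot_basis_vec u i : dot u (basis_vec R i) = u 0 i.
Proof.
rewrite /dot (bigD1 i)//= big1 ?addr0 => [|j ji].
  by rewrite mxE !eqxx mulr1.
by rewrite mxE (negbTE ji) andbF mulr0.
Qed.

Lemma coord_le_norm u i : `|u 0 i| <= `|u|.
Proof.
rewrite [leRHS]/Num.Def.normr/= mx_normrE.
exact: (le_bigmax _ (fun ij => `|u ij.1 ij.2|) (ord0, i)).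
Qed.

Lemma norm_dot u v : `|dot u v| <= n%:R * (`|u| * `|v|).
Proof.
rewrite (le_trans (ler_norm_sum _ _ _))//.
have -> : n%:R * (`|u| * `|v|) = \sum_(i < n) `|u| * `|v|.
  by rewrite sumr_const card_ord mulr_natl.
rewrite ler_sum// => i _.
by rewrite normrM ler_pM// coord_le_norm.
Qed.

Lemma differentiable_dot u v : differentiable (dot u) v.
Proof.
have -> : dot u = \sum_i (u 0 i *: (fun w : 'rV[R]_n => w 0 i)).
  by apply/funext => w; rewrite fct_sumE.
apply: differentiable_sum => i; apply: differentiableZ.
exact: differentiable_coord.
Qed.

End dot_product.

Section gradient_map.
Context {R : realType} {n : nat} {M : set 'rV[R]_n} {Psi : 'rV[R]_n -> R}.
Hypothesis M_open : open M.
Hypothesis Psi_C2 : Ck 2 M Psi.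

Local Notation theta := (gradient Psi).
Local Notation H := (hessian Psi).

Let dPsi x : M x -> differentiable Psi x.
Proof. by case: Psi_C2 => dPsi _; exact: dPsi. Qed.

Let dDPsi v x : M x -> differentiable ('D_v Psi) x.
Proof. by move=> Mx; have [_ /(_ v)[+ _]] := Psi_C2; exact. Qed.

Lemma trmx_hessian x : M x -> (H x)^T = H x.
Proof.
move=> Mx; apply/matrixP => i j; rewrite !mxE.
exact: derive_mixedC M_open Psi_C2 Mx.
Qed.

Lemma differentiable_gradient x : M x -> differentiable theta x.
Proof.
move=> Mx; have -> : theta = \sum_j (fun z => 'D_(basis_vec R j) Psi z *: delta_mx 0 j).
  apply/funext => z; rewrite fct_sumE [LHS]row_sum_delta.
  by apply: eq_bigr => j _; rewrite mxE.
by apply: differentiable_sum => j; apply: differentiableZl; exact: dDPsi.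
Qed.

Lemma derive_gradient x v : M x -> 'D_v theta x = v *m H x.
Proof.
move=> Mx; rewrite derive_mx; last exact/diff_derivable/differentiable_gradient.
apply/rowP => j; rewrite !mxE /=.
under eq_fun do rewrite mxE.
rewrite derive_coordE; last exact: dDPsi.
by apply: eq_bigr => i _; rewrite mxE.
Qed.

Lemma is_derive_gradient_curve (gamma : R -> 'rV[R]_n) t v :
  M (gamma t) -> is_derive t 1 gamma v ->
  is_derive t 1 (theta \o gamma) (v *m H (gamma t)).
Proof.
move=> Mg dg; rewrite -(derive_gradient _ v Mg).
exact: (is_derive_comp_curve _ _ _ _ dg (differentiable_gradient _ Mg)).
Qed.

Lemma derive_dot_gradient x v : M x -> 'D_v Psi x = dot (theta x) v.
Proof.
move=> Mx; rewrite derive_coordE; last exact: dPsi.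
by apply: eq_bigr => i _; rewrite mxE mulrC.
Qed.

Lemma derive2_hessian x v w : M x ->
  'D_v ('D_w Psi) x = hessian_metric Psi x v w.
Proof.
move=> Mx; rewrite derive_coordE; last exact: dDPsi.
rewrite /hessian_metric -mulmxA mxE; apply: eq_bigr => i _; congr (_ * _).
rewrite (derive_mixedC _ _ (basis_vec R i) w _ M_open Psi_C2 Mx).
rewrite (derive_coordE _ _ w (dDPsi (basis_vec R i) _ Mx)).
rewrite [RHS]mxE; apply: eq_bigr => j _; rewrite [X in _ = X * _]mxE [in RHS]mxE [RHS]mulrC.
by rewrite (derive_mixedC _ _ (basis_vec R j) (basis_vec R i) _ M_open Psi_C2 Mx).
Qed.

Hypothesis Psi_posdef : positive_definite_on M (hessian_metric Psi).

Lemma hessian_unit x : M x -> H x \in unitmx.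
Proof.
move=> Mx; rewrite -row_free_unit; apply: inj_row_free => v vH0.
apply/eqP/negPn/negP => v0; have := Psi_posdef x v Mx v0.
by rewrite /hessian_metric vH0 mul0mx mxE ltxx.
Qed.

(** Strict convexity of Psi along a segment of M: its derivative in the
    direction v is increasing there because its own derivative is the metric at
    v. *)
Lemma lt_tangent_segment p v : v != 0 ->
  (forall t : R, 0 <= t <= 1 -> M (p + t *: v)) ->
  'D_v Psi p < Psi (p + v) - Psi p.
Proof.
move=> v0 Mpv.
have [|t /andP[t0 t1]] := MVT_line Psi p v 1 ltr01.
  by move=> t t01; apply: dPsi; exact: Mpv.
rewrite scale1r mul1r => ->.
have Mt s : 0 <= s <= t -> M (p + s *: v).
  by move=> /andP[s0 st]; apply: Mpv; rewrite s0 (le_trans st)// ltW.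
have [|s /andP[s0 st]] := MVT_line ('D_v Psi) p v t t0.
  by move=> s ?; apply: dDPsi; exact: Mt.
rewrite -subr_gt0 => ->; rewrite mulr_gt0// derive2_hessian; last first.
  by apply: Mt; rewrite !ltW.
by apply: Psi_posdef => //; apply: Mt; rewrite !ltW.
Qed.

End gradient_map.

(** * The gradient map is open *)

Lemma compact_sub_closed_ball {R : realType} {n : nat} (p : 'rV[R]_n) (r : R)
    (A : set 'rV[R]_n) :
  closed A -> A `<=` [set u | `|p - u| <= r] -> compact A.
Proof.
move=> clA Ar; apply: bounded_closed_compact => //.
exists (`|p| + r); split; first exact: num_real.
move=> x px u /Ar /= pur; rewrite (le_trans _ (ltW px))//.
by rewrite -[u](subKr p) (le_trans (ler_normB _ _))// lerD.
Qed.

Section gradient_open.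
Context {R : realType} {n : nat} {M : set 'rV[R]_n} {Psi : 'rV[R]_n -> R}.
Hypothesis M_open : open M.
Hypothesis Psi_C2 : Ck 2 M Psi.
Hypothesis Psi_posdef : positive_definite_on M (hessian_metric Psi).

Let dPsi x : M x -> differentiable Psi x.
Proof. by case: Psi_C2 => dPsi _; exact: dPsi. Qed.

(** Fermat's rule for Psi - <tau, .>, whose gradient is theta - tau. *)
Lemma tilted_critical (tau c : 'rV[R]_n) (rho : R) : 0 < rho ->
  (forall u, `|u - c| < rho -> M u /\ Psi c - dot tau c <= Psi u - dot tau u) ->
  gradient Psi c = tau.
Proof.
move=> rho0 cmin.
have Mc : M c by have [] := cmin c; rewrite ?subrr ?normr0.
apply/rowP => i; rewrite -[LHS]dot_basis_vec -[RHS]dot_basis_vec.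
set v := basis_vec R i.
have v0 : 0 < `|v| + 1 by rewrite ltr_wpDl.
pose a := rho / (`|v| + 1); have a0 : 0 < a by rewrite divr_gt0.
have line_ball s : s \in `](- a), a[ -> `|c + s *: v - c| < rho.
  rewrite in_itv/= -ltr_norml => sa; rewrite addrC addKr normrZ.
  rewrite (@le_lt_trans _ _ (`|s| * (`|v| + 1)))//; first by rewrite ler_wpM2l ?lerDl.
  by rewrite -ltr_pdivlMr.
have df s : s \in `](- a), a[ ->
    is_derive s 1 (fun s => Psi (c + s *: v) - (dot tau c + s *: dot tau v))
      (dot (gradient Psi (c + s *: v)) v - dot tau v).
  move=> /line_ball /cmin[Ms _]; apply: is_deriveB.
    rewrite -(derive_dot_gradient Psi_C2 _ _ Ms).
    exact: (is_derive_comp_curve Psi _ _ _ (is_derive_line c v s) (dPsi _ Ms)).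
  exact: is_derive_line.
have a00 : 0 \in `](- a), a[ by rewrite in_itv/= oppr_lt0 a0.
have aa : - a <= a by rewrite ge0_cp// ltW.
have cmin_line s : s \in `](- a), a[ ->
    Psi (c + 0 *: v) - (dot tau c + 0 *: dot tau v) <=
    Psi (c + s *: v) - (dot tau c + s *: dot tau v).
  move=> sa; have [_] := cmin _ (line_ball s sa).
  by rewrite dotDr dotZr !scale0r !addr0.
have [_ D0] := @derive1_at_min R _ _ _ _ aa
  (fun s sa => @ex_derive _ _ _ _ _ _ _ (df s sa)) a00 cmin_line.
have [_] := df 0 a00; rewrite D0 scale0r addr0 => /esym/eqP.
by rewrite subr_eq0 => /eqP.
Qed.

(** Strict convexity and the compactness of the sphere give a uniform gap
    between Psi and its tangent plane at p.  The sphere is empty when n = 0. *)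
Lemma sphere_gap p r : 0 < r -> (forall u, `|p - u| <= r -> M u) ->
  exists2 m, 0 < m & forall u, `|p - u| = r ->
    m <= Psi u - Psi p - dot (gradient Psi p) (u - p).
Proof.
move=> r0 ballM; pose S := [set u : 'rV[R]_n | `|p - u| = r].
have [[u0 Su0]|S0] := pselect (S !=set0); last first.
  by exists 1 => // u Su; exfalso; apply: S0; exists u.
pose g u := Psi u - Psi p - dot (gradient Psi p) (u - p).
have SM u : S u -> M u by move=> Su; apply: ballM; rewrite (Su : _ = _).
have clS : closed S.
  rewrite /S -/((Num.norm \o (fun u => p - u)) @^-1` [set x | x = r]).
  apply: (preimage_closed _ (@closed_eq _ r)) => y _.
  apply: (continuous_comp _ (@norm_continuous _ _ _)).
  exact: (continuousB (@cst_continuous _ _ _ _)).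
have cg : {within S, continuous g}.
  apply: continuous_in_subspaceT => u /set_mem Su.
  apply: differentiable_continuous.
  have -> : g = Psi - cst (Psi p - dot (gradient Psi p) p) - dot (gradient Psi p).
    apply/funext => z; rewrite /g dotBr.
    rewrite -[RHS]/(Psi z - (Psi p - dot (gradient Psi p) p) - dot (gradient Psi p) z).
    by rewrite opprB addrA addrAC; ring.
  apply: differentiableB; last exact: differentiable_dot.
  by apply: differentiableB => //; exact/dPsi/SM.
have [|c /set_mem Sc cmin] := EVT_min_rV (ex_intro _ u0 Su0) _ cg.
  by apply: (compact_sub_closed_ball p r _ clS) => u /= ->.
exists (g c); last by move=> u Su; apply: cmin; exact/mem_set.
have cp0 : c - p != 0.
  by rewrite subr_eq0 eq_sym -subr_eq0 -normr_gt0 (Sc : _ = r).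
rewrite /g subr_gt0 -(derive_dot_gradient Psi_C2); last by apply: ballM; rewrite subrr normr0 ltW.
have := lt_tangent_segment M_open Psi_C2 Psi_posdef p _ cp0.
rewrite [p + _]addrC subrK; apply => t /andP[t0 t1]; apply: ballM.
rewrite opprD addNKr normrN normrZ ger0_norm// distrC (Sc : _ = r).
by rewrite ler_piMl// ltW.
Qed.

(** On the sphere of radius r around p, the tangent gap m beats the
    perturbation <tau - theta(p), u - p>, at most n |tau - theta(p)| r in the
    sup norm; hence the minimum over the closed ball of Psi - <tau, .> lies in
    its interior, where it is a critical point. *)
Lemma gradient_open_map p (U : set 'rV[R]_n) : M p -> nbhs p U ->
  \forall tau \near gradient Psi p, exists u, [/\ M u, U u & gradient Psi u = tau].
Proof.
move=> Mp Up.
have [r' /= r'0 ball_MU] :=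
  (nbhs_normP _ _).1 (filterI (open_nbhs_nbhs (conj M_open Mp)) Up).
pose r := r' / 2; have r0 : 0 < r by rewrite divr_gt0.
have {}ball_MU u : `|p - u| <= r -> M u /\ U u.
  move=> pur; apply: ball_MU; rewrite /ball_/= (le_lt_trans pur)//.
  by rewrite ltr_pdivrMr// ltr_pMr// ltr1n.
have [m m0 gap] := sphere_gap p r r0 (fun u h => (ball_MU u h).1).
have d0 : 0 < m / (n.+1%:R * r) by rewrite divr_gt0// mulr_gt0.
(* The factor n + 1 instead of n avoids a division by zero when n = 0. *)
apply/nbhs_normP; exists (m / (n.+1%:R * r)) => // tau /= tau_near.
pose f u := Psi u - dot tau u; pose B := [set u : 'rV[R]_n | `|p - u| <= r].
have Bp : B p by rewrite /B/= subrr normr0 ltW.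
have clB : closed B by exact: closed_closed_ball_.
have cf : {within B, continuous f}.
  apply: continuous_in_subspaceT => u /set_mem Bu.
  apply: differentiable_continuous.
  apply: (@differentiableB _ _ _ Psi); last exact: differentiable_dot.
  exact/dPsi/(ball_MU u Bu).1.
have [|c /set_mem Bc cmin] := EVT_min_rV (ex_intro _ p Bp) _ cf.
  exact: (compact_sub_closed_ball p r _ clB).
have [Mc Uc] := ball_MU c Bc.
exists c; split=> //.
have pcr : `|p - c| < r.
  rewrite lt_neqAle (Bc : is_true _) andbT; apply/eqP => Sc.
  have gapc := gap c Sc.
  have fcp : f c <= f p by apply: cmin; exact/mem_set.
  have := norm_dot (gradient Psi p - tau) (c - p).
  rewrite ler_norml => /andP[+ _]; rewrite dotBl [`|c - p|]distrC Sc => low.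
  have : n%:R * (`|gradient Psi p - tau| * r) < m.
    have : n%:R * (`|gradient Psi p - tau| * r) <= n.+1%:R * (`|gradient Psi p - tau| * r).
      by rewrite ler_wpM2r ?ler_nat// mulr_ge0// ltW.
    move=> /le_lt_trans; apply; rewrite mulrCA -ltr_pdivlMr//.
    by rewrite mulr_gt0.
  move: fcp gapc low; rewrite /f !dotBr; lra.
apply: (tilted_critical tau c (r - `|p - c|)); first by rewrite subr_gt0.
move=> u uc; have Bu : B u.
  rewrite /B/= (le_trans (ler_distD c _ _))// [`|c - u|]distrC.
  by rewrite -lerBrDl ltW.
by split; [exact: (ball_MU u Bu).1|apply: cmin; exact/mem_set].
Qed.

End gradient_open.

(** * Geodesics of the dual connection *)

Section dual_geodesics.
Context {R : realType} {n : nat} {M : set 'rV[R]_n} {Psi : 'rV[R]_n -> R}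
  {Dstar : connection R n}.
Hypothesis M_open : open M.
Hypothesis Psi_C4 : Ck 4 M Psi.
Hypothesis Psi_posdef : positive_definite_on M (hessian_metric Psi).
Hypothesis Dstar_dual : dual_connection M (hessian_metric Psi) flat_connection Dstar.

Local Notation theta := (gradient Psi).
Local Notation H := (hessian Psi).

Let Psi_C2 : Ck 2 M Psi.
Proof.
have [dPsi C3] := Psi_C4; split => // v; have [dPsiv C2] := C3 v; split => // w x Mx.
by apply: differentiable_continuous; have [dPsivw _] := C2 w; exact: dPsivw.
Qed.

Lemma differentiable_hessian i j x : M x -> differentiable (fun z => H z i j) x.
Proof.
move=> Mx; under eq_fun do rewrite mxE.
have [_ /(_ (basis_vec R j))[_ /(_ (basis_vec R i))[dH _]]] := Psi_C4.
exact: dH.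
Qed.

Lemma vector_field_cst v : vector_field M (cst v).
Proof.
split=> [x _|w x _]; first exact: differentiable_cst.
rewrite (_ : 'D_w (cst v) = cst 0); first exact: cst_continuous.
by apply/funext => z; exact: derive_cst.
Qed.

(** The duality relation for the constant fields e_i, e_k, e_j; their
    derivatives for the flat connection vanish, so only the term in D*
    remains. *)
Lemma christoffel_mul_hessian x i j : M x ->
  christoffel Dstar x i j *m H x =
  \row_k 'D_(basis_vec R i) (fun z => H z j k) x.
Proof.
move=> Mx; apply/rowP => k; rewrite [RHS]mxE.
have := Dstar_dual _ _ _ (vector_field_cst (basis_vec R i))
  (vector_field_cst (basis_vec R k)) (vector_field_cst (basis_vec R j)) x Mx.
rewrite /flat_connection -/(christoffel Dstar x i j) /cst derive_cst.
rewrite {2}/hessian_metric !mul0mx mxE add0r => dualE.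
have gE z : hessian_metric Psi z (basis_vec R k) (basis_vec R j) = H z k j.
  by rewrite /hessian_metric -rowE trmx_delta -colE !mxE.
rewrite (_ : (fun z => _) = fun z => H z k j) in dualE; last exact/funext.
transitivity ('D_(basis_vec R i) (fun z => H z k j) x); last first.
  apply: near_eq_derive; have := open_nbhs_nbhs (conj M_open Mx).
  apply: filterS => z Mz.
  by rewrite -[in LHS](trmx_hessian M_open Psi_C2 z Mz) [LHS]mxE.
rewrite dualE /hessian_metric -rowE -[in LHS](trmx_hessian M_open Psi_C2 x Mx).
rewrite [LHS]mxE [RHS]mxE; apply: eq_bigr => l _.
by rewrite !mxE mulrC.
Qed.

(** The row gamma' H(gamma) is the velocity of gamma in the dual coordinates,
    so this is the acceleration in these coordinates.  The derivative of
    H(gamma) contributes sum_ij gamma'_i gamma'_j d_i H_jk, which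
    [christoffel_mul_hessian] turns into the Christoffel term. *)
Lemma is_derive_momentum (gamma : R -> 'rV[R]_n) (t : R) :
  M (gamma t) -> derivable gamma t 1 -> derivable (derive1 gamma) t 1 ->
  is_derive t 1 (fun s => derive1 gamma s *m H (gamma s))
    (covariant_acceleration Dstar gamma t *m H (gamma t)).
Proof.
move=> Mg dg ddg; set v := derive1 gamma t.
have dgE : is_derive t 1 gamma v.
  rewrite /v derive1E; exact: (derivableP dg).
pose dH := \matrix_(j, k) 'D_v (fun z => H z j k) (gamma t).
have dHE : is_derive t 1 (fun s => H (gamma s)) dH.
  apply: is_derive_mx => j k; rewrite mxE.
  exact: (is_derive_comp_curve _ _ _ _ dgE (differentiable_hessian j k _ Mg)).
have := is_derive_mulmx _ _ _ _ _ (derivableP ddg) dHE.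
rewrite -derive1E -/v.
suff -> : covariant_acceleration Dstar gamma t *m H (gamma t) =
   derive1 (derive1 gamma) t *m H (gamma t) + v *m dH by [].
rewrite /covariant_acceleration mulmxDl -/v; congr (_ + _).
apply/rowP => k.
transitivity (\sum_i \sum_j
    v 0 i * v 0 j * 'D_(basis_vec R i) (fun z => H z j k) (gamma t)).
  rewrite mulmx_suml summxE; apply: eq_bigr => i _.
  rewrite mulmx_suml summxE; apply: eq_bigr => j _.
  by rewrite -scalemxAl (christoffel_mul_hessian _ _ _ Mg) [LHS]mxE [X in _ * X]mxE.
rewrite exchange_big [RHS]mxE; apply: eq_bigr => j _.
rewrite [dH j k]mxE (derive_coordE _ _ v (differentiable_hessian j k _ Mg)) mulr_sumr.
apply: eq_bigr => i _; rewrite [RHS]mulrA; congr (_ * _).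
exact: mulrC.
Qed.

Lemma gradient_geodesic_affine (gamma : R -> 'rV[R]_n) (a b : R) :
  a < 0 -> 1 < b -> geodesic_on M Dstar a b gamma ->
  forall t, 0 <= t <= 1 ->
  theta (gamma t) = (1 - t) *: theta (gamma 0) + t *: theta (gamma 1).
Proof.
move=> a0 b1 geo t t01; apply/rowP => k.
rewrite [RHS]mxE [X in _ = X + _]mxE [X in _ = _ + X]mxE.
pose f (s : R) : R := theta (gamma s) 0 k.
pose df (s : R) : R := (derive1 gamma s *m H (gamma s)) 0 k.
apply: (affine_of_derive2_0 f df _ _ a0 b1 _ _ t t01) => s sab.
- have [Mg dg ddg acc0] := geo s sab.
  have := is_derive_gradient_curve Psi_C2 _ _ _ Mg (derivableP dg).
  rewrite -derive1E => /is_derive_coord; exact.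
- have [Mg dg ddg acc0] := geo s sab.
  have := is_derive_momentum _ _ Mg dg ddg.
  by rewrite acc0 mul0mx => /is_derive_coord /(_ 0 k); rewrite mxE.
Qed.

Lemma gradient_line_near (tau d u : 'rV[R]_n) (t : R) (U : set 'rV[R]_n) :
  M u -> nbhs u U -> theta u = tau + t *: d ->
  \forall s \near t, exists u', [/\ M u', U u' & theta u' = tau + s *: d].
Proof.
move=> Mu Uu thetau.
have openmap := gradient_open_map M_open Psi_C2 Psi_posdef _ _ Mu Uu.
have cline : {for t, continuous (fun s : R => tau + s *: d)}.
  apply: differentiable_continuous; apply/derivable1_diffP.
  exact: (@ex_derive _ _ _ _ _ _ _ (is_derive_line tau d t)).
by rewrite thetau in openmap; exact: (cline _ openmap).
Qed.

(** The continuity of gamma comes from theta being open and injective, its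
    differentiability from the Jacobian matrix H of theta being invertible. *)
Lemma dual_geodesic_of_affine (gamma : R -> 'rV[R]_n) (a b : R) (tau d : 'rV[R]_n) :
  set_inj M theta ->
  (forall t, a < t < b -> M (gamma t) /\ theta (gamma t) = tau + t *: d) ->
  geodesic_on M Dstar a b gamma.
Proof.
move=> theta_inj gammaE.
have near_ab t : a < t < b -> \forall s \near t, a < s < b.
  move=> tab; have tin : t \in `]a, b[ by rewrite in_itv.
  by apply: filterS (near_in_itvoo tin) => s; rewrite in_itv.
have cgamma t : a < t < b -> {for t, continuous gamma}.
  move=> tab U /= Ug; have [Mg thetag] := gammaE t tab.
  have nearU := gradient_line_near _ _ _ _ _ Mg Ug thetag.
  apply: filterS2 (near_ab t tab) nearU => s /gammaE [Mgs thetas] [u [Mu Uu thetau]].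
  rewrite /= (_ : gamma s = u)//.
  by apply: theta_inj; rewrite ?inE// thetas.
pose K t := invmx (H (gamma t)).
have dgamma t : a < t < b -> is_derive t 1 gamma (d *m K t).
  move=> tab; have [Mg thetag] := gammaE t tab.
  have unitH := hessian_unit Psi_posdef _ Mg.
  pose E u := u - theta u *m K t.
  have dE : differentiable E (gamma t).
    apply: (@differentiableB _ _ _ id); first exact: ex_diff.
    apply: (@differentiable_comp _ _ _ _ theta (fun u => u *m K t)).
      exact: (differentiable_gradient Psi_C2).
    exact: differentiable_mulmxr.
  have E0 v : 'D_v E (gamma t) = 0.
    have line0 : gamma t + 0 *: v = gamma t by rewrite scale0r addr0.
    have dline := is_derive_line (gamma t) v 0.
    have dE1 : is_derive (0 : R) 1 (E \o (fun s => gamma t + s *: v)) ('D_v E (gamma t)).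
      have := is_derive_comp_curve E (fun s : R => gamma t + s *: v) 0 v dline.
      rewrite line0 => dEline; exact: (dEline dE).
    have Ml : M (gamma t + 0 *: v) by rewrite line0.
    have := is_derive_mulmxr _ (K t) _ _ (is_derive_gradient_curve Psi_C2 _ _ _ Ml dline).
    move=> /(is_deriveB dline) dE2.
    rewrite (is_derive_uniq _ _ _ _ _ dE1 dE2) line0 -mulmxA mulmxV// mulmx1.
    exact: subrr.
  apply: (is_derive_implicit E _ (fun s => (tau + s *: d) *m K t) _ _ (cgamma t tab) dE E0).
    apply: filterS (near_ab t tab) => s /gammaE[_ <-].
    by rewrite /E subrK.
  exact: (is_derive_mulmxr _ _ _ _ (is_derive_line _ _ _)).
have dH t : a < t < b -> derivable (fun s => H (gamma s)) t 1.
  move=> tab; apply/derivable_mxP => i j; have [Mg _] := gammaE t tab.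
  exact: (@ex_derive _ _ _ _ _ _ _
    (is_derive_comp_curve _ _ _ _ (dgamma t tab) (differentiable_hessian i j _ Mg))).
have velocity t : a < t < b -> derive1 gamma t = d *m K t.
  by move=> /dgamma[_ <-]; rewrite derive1E.
move=> t tab; have [Mg _] := gammaE t tab.
have dgt : derivable gamma t 1 := @ex_derive _ _ _ _ _ _ _ (dgamma t tab).
have ddgt : derivable (derive1 gamma) t 1.
  apply: (@near_eq_derivable _ _ _ (fun s => d *m K s)).
    by apply: filterS (near_ab t tab) => s /velocity.
  have dK : derivable K t 1.
    apply: (derivable_invmx _ _ (dH t tab)); apply: filterS (near_ab t tab) => s /gammaE[Ms _].
    exact: (hessian_unit Psi_posdef).
  exact: (@ex_derive _ _ _ _ _ _ _
    (is_derive_mulmx _ _ _ _ _ (is_derive_cst d t 1) (derivableP dK))).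
split; [exact: Mg|exact: dgt|exact: ddgt|].
have momentum0 : is_derive t 1 (fun s => derive1 gamma s *m H (gamma s)) 0.
  apply: (near_eq_is_derive _ (is_derive_cst d t 1)).
  apply: filterS (near_ab t tab) => s sab; have [Ms _] := gammaE s sab.
  by rewrite velocity// -mulmxA mulVmx ?mulmx1// (hessian_unit Psi_posdef).
have := is_derive_uniq _ _ _ _ _ (is_derive_momentum _ _ Mg dgt ddgt) momentum0.
by move=> /(congr1 (mulmx^~ (K t))); rewrite mul0mx mulmxK// (hessian_unit Psi_posdef).
Qed.

End dual_geodesics.

(** * Convexity for the cost and for the dual connection *)

Lemma cost_gradx_psi_cost {R : realType} {n : nat} (f : 'rV[R]_n -> R) (x y : 'rV[R]_n) :
  cost_gradx (psi_cost f) x y = gradient f (x - y).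
Proof.
apply/rowP => i; rewrite !mxE /psi_cost /derive.
pose q (h : R) := h^-1 *: ((f \o shift (x - y)) (h *: basis_vec R i) - f (x - y)).
suff -> : (fun h : R => h^-1 *: (((fun z => f (z - y)) \o shift x)
  (h *: basis_vec R i) - f (x - y))) = q by [].
by apply/funext => h; rewrite /q /= addrA.
Qed.

Theorem proposition8 (R : realType) (n : nat)
    (X Y M : set 'rV[R]_n) (Psi : 'rV[R]_n -> R) (Dstar : connection R n)
    (X_dom : open_domain X) (Y_dom : open_domain Y) (M_dom : open_domain M)
    (XY_sub_M : [set x - y | x in X & y in Y] `<=` M)
    (Psi_C4 : Ck 4 M Psi)
    (Psi_convex : convex_on M Psi)
    (Psi_posdef : positive_definite_on M (hessian_metric Psi))
    (theta_inj : set_inj M (gradient Psi))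
    (Dstar_dual :
       dual_connection M (hessian_metric Psi) flat_connection Dstar) :
  c_convex_relative_to (psi_cost Psi) Y X <->
  (forall x, X x -> geodesically_convex M Dstar [set x - y | y in Y]).
Proof.
have segE (x y0 y1 : 'rV[R]_n) (t : R) :
    gradient Psi (x - y0) + t *: (gradient Psi (x - y1) - gradient Psi (x - y0)) =
    - ((1 - t) *: - cost_gradx (psi_cost Psi) x y0 +
       t *: - cost_gradx (psi_cost Psi) x y1).
  rewrite !cost_gradx_psi_cost !scalerN -opprD opprK scalerBl scale1r scalerBr.
  by rewrite addrA addrAC.
split=> [Yconvex x Xx _ _ [y0 Yy0 <-] [y1 Yy1 <-]|Yconvex x Xx y0 y1 Yy0 Yy1 t t01].
  set tau := gradient Psi (x - y0); set d := gradient Psi (x - y1) - tau.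
  have seg t : 0 <= t <= 1 -> exists2 y, Y y & gradient Psi (x - y) = tau + t *: d.
    move=> /(Yconvex x Xx y0 y1 Yy0 Yy1 t)[y Yy py]; exists y => //.
    by rewrite segE -[LHS]cost_gradx_psi_cost py opprK.
  have subM y : Y y -> M (x - y) by move=> Yy; apply: XY_sub_M; exists x => //; exists y.
  (* W is the set of parameters at which the line meets the range of theta: it
     contains [0, 1] by c-convexity, and a neighbourhood of it by openness. *)
  pose W t := exists u, M u /\ gradient Psi u = tau + t *: d.
  have Wnear t : 0 <= t <= 1 -> exists2 e : R, 0 < e & forall s, `|t - s| < e -> W s.
    move=> /seg[y /subM My thetay].
    have nbhsT : nbhs (x - y) [set: 'rV[R]_n] by exact: filterT.
    have near_t := gradient_line_near M_dom.1 Psi_C4 Psi_posdef _ _ _ _ _ My nbhsT thetay.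
    have [e e0 We] := (nbhs_normP _ _).1 near_t.
    by exists e => // s /We[u [Mu _ thetau]]; exists u.
  have [e0 e0_gt0 W0] := Wnear 0 ltac:(by rewrite lexx ler01).
  have [e1 e1_gt0 W1] := Wnear 1 ltac:(by rewrite lexx ler01).
  have Wab t : - e0 < t < 1 + e1 -> W t.
    move=> /andP[e0t te1]; have [t0|t0] := ltP t 0.
      by apply: W0; rewrite sub0r normrN ltr0_norm// ltrNl.
    have [t1|t1] := leP t 1.
      by have [|y /subM My thetay] := seg t; [rewrite t0|exists (x - y)].
    by apply: W1; rewrite distrC gtr0_norm ?subr_gt0// ltrBlDl.
  pose gamma t := xget 0 [set u | M u /\ gradient Psi u = tau + t *: d].
  have gammaE t : - e0 < t < 1 + e1 ->
      M (gamma t) /\ gradient Psi (gamma t) = tau + t *: d.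
    by move=> /Wab; exact: xgetPex.
  have gamma_seg t y : 0 <= t <= 1 -> Y y -> gradient Psi (x - y) = tau + t *: d ->
      gamma t = x - y.
    move=> /andP[t0 t1] /subM My thetay; have [|Mg thetag] := gammaE t.
      by rewrite (lt_le_trans _ t0) ?oppr_lt0//= (le_lt_trans t1)// ltrDl.
    by apply: theta_inj; rewrite ?inE// thetag thetay.
  exists gamma, (- e0), (1 + e1); split.
  - by rewrite oppr_lt0 ltrDl.
  - exact: (dual_geodesic_of_affine M_dom.1 Psi_C4 Psi_posdef Dstar_dual _ _ _ tau d).
  - split; apply: gamma_seg => //; rewrite ?lexx ?ler01//.
      by rewrite scale0r addr0.
    by rewrite scale1r /d [RHS]addrC subrK.
  - by move=> t t01; have [y Yy thetay] := seg t t01; exists y; rewrite // (gamma_seg t y).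
have [gamma [a [b [[a0 b1] geo [gamma0 gamma1] gammaY]]]] :=
  Yconvex x Xx (x - y0) (x - y1) (ex_intro2 _ _ y0 Yy0 erefl) (ex_intro2 _ _ y1 Yy1 erefl).
have [y Yy gammat] := gammaY t t01; exists y => //.
have := gradient_geodesic_affine M_dom.1 Psi_C4 Dstar_dual _ _ _ a0 b1 geo t t01.
rewrite gamma0 gamma1 -gammat /c_exp !cost_gradx_psi_cost => ->.
by rewrite !scalerN -opprD.
Qed.
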